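(* Let $\mathcal{G}$ be a metric graph satisfying the standing hypotheses (i)–(vi) listed in the context, with $x_0$ the vertex appearing there, and let $\sigma>1$. Suppose that the potential $V:\mathcal{G}\to\mathbb{R}$ is a positive function satisfying $$\sum_{x\in\mathcal{V}\cap B_R^c}\mu_{\mathcal{V}}(x)V^{-\frac1{\sigma-1}}(x)e^{-\alpha d(x,x_0)}\le CR^{\frac{\sigma}{\sigma-1}},\qquad \sum_{e\in\mathcal{E}\cap B_R^c}\int_0^{l_e}V_e^{-\frac1{\sigma-1}}(x)e^{-\alpha d(x,x_0)}\,dx\le CR^{\frac{\sigma}{\sigma-1}},\qquad\forall\ R\ge R_0,$$ for some $\alpha=\delta/R>0$ and $C>0$. If $u$ is a solution (with no sign restriction) of $\Delta_{\mathcal{G}}u+V|u|^\sigma\le0$ in $\mathcal{G}$ and $u\in X_\alpha$, then $u\equiv0$ on $\mathcal{G}$.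
   Context: **Metric graph.** Let $(\mathcal{V},E,l)$ be a weighted graph: $\mathcal{V}$ a countable set of vertices, $E$ a countable set of edges, $l:E\to(0,+\infty]$, $l_e:=l(e)$ the length of $e$. The metric graph $\mathcal{G}$ over $(\mathcal{V},E,l)$ is the pair $(\mathcal{V},\mathcal{E})$ with $\mathcal{E}=\bigcup_{e\in E}\{e\}\times(0,l_e)$; its points are the vertices and the interior points of edges. Each edge $e$ has an initial vertex $i(e)$ and a final vertex $j(e)$; $e$ is identified with the interval $I_e=(0,l_e)$, $\mathcal{G}_e=\{e\}\times I_e$, and $i(e),j(e)$ correspond to the endpoints $0,l_e$ of $\overline{I}_e=[0,l_e]$. Write $e\ni v$ if $v=i(e)$ or $v=j(e)$, and $y\sim x$ if the vertices $x,y$ are joined by an edge. (One writes $e\in\mathcal{E}$ for edges too.) For $x,y\in\mathcal{G}$, $d(x,y)$ is the infimum of the lengths of paths in $\mathcal{G}$ joining $x$ and $y$ (interior points may be added as vertices, the length of a path being the sum of the lengths of its segments). $B_R=B_R(x_0)=\{x\in\mathcal{G}: d(x,x_0)<R\}$ and $B_R^c=\{x\in\mathcal{G}: d(x,x_0)\ge R\}$. A sum over $e\in\mathcal{E}\cap B_R^c$ is a sum over the edges $e$ that meet $B_R^c$. **Functions and measures.** For $f:\mathcal{G}\to\mathbb{R}$, $f_e$ is its restriction to $\overline{I}_e$. $\mathcal{F}_0$ is the set of $f:\mathcal{G}\to\mathbb{R}$ having, at each vertex, a common value from all incident edges; $C(\mathcal{G})$ is the set of $f\in\mathcal{F}_0$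 with every $f_e\in C([0,l_e])$. $\mu_{\mathcal{V}}:\mathcal{V}\to(0,\infty)$ is a vertex measure, and $\mu_{\mathcal{E}}$ is Lebesgue measure on the edges. **The number $\alpha$ and the space $X_\alpha$.** $R_0:=\max\{2j,1\}$, with $j$ the supremum of the edge lengths (see (vi) below). For a given constant $\delta>0$ and fixed $R\ge R_0$, one writes $\alpha=\delta/R$, and $X_\alpha=L^1_{e^{-\alpha d(\cdot,x_0)}}(\mathcal{G})$ is the set of $f\in\mathcal{F}_0$ with $$\sum_{x\in\mathcal{V}}\mu_{\mathcal{V}}(x)|f(x)|e^{-\alpha d(x,x_0)}+\sum_{e\in\mathcal{E}}\int_0^{l_e}|f_e(x)|e^{-\alpha d(x,x_0)}\,dx<+\infty .$$ **Laplacians.** $\omega:E\to(0,\infty)$ is a symmetric positive weight, $\omega(x,y)=\omega(y,x)$. For a vertex $x$, $\Delta_{\mathcal{V}}f(x)=\frac{1}{\mu_{\mathcal{V}}(x)}\sum_{y\sim x}\omega(x,y)(f(y)-f(x))$; for $x\in I_e$, $\Delta_{\mathcal{E}}f(x)=f_e''(x)$. Formally $\Delta_{\mathcal{G}}f=(\Delta_{\mathcal{V}}f)\,d\mu_{\mathcal{V}}+(\Delta_{\mathcal{E}}f)\,d\mu_{\mathcal{E}}$. Let $$\mathcal{D}(\mathcal{G})=\{f\in C(\mathcal{G}): f_e\in C^2(I_e)\cap C^1(\overline{I}_e),\ f_e''\in L^\infty(I_e)\ \forall e\}.$$ For a vertex $v\in e$, $\frac{df_e(v)}{dn}=f_e'(v)$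 if $j(e)=v$ and $=-f_e'(v)$ if $i(e)=v$; $[\mathcal{K}(f)](x)=\sum_{e\ni x}\frac{df_e(x)}{dn}$ for $x\in\mathcal{V}$. **Solutions.** $u$ is a solution of $\Delta_{\mathcal{G}}u+V|u|^\sigma\le0$ in $\mathcal{G}$ if $u\in\mathcal{D}(\mathcal{G})$, $u_e''(x)+V_e(x)|u_e(x)|^\sigma\le0$ for every edge $e$ and $x\in(0,l_e)$, $\Delta_{\mathcal{V}}u(x)+V(x)|u(x)|^\sigma\le0$ for every $x\in\mathcal{V}$, and $[\mathcal{K}(u)](x)=0$ for every $x\in\mathcal{V}$. **Standing hypotheses.** (i) $\mathcal{G}$ is infinite ($E$ and $\mathcal{V}$ not both finite), connected, and locally finite (each vertex has finitely many incident edges). (ii) $l_e<+\infty$ and $i(e)\ne j(e)$ for all edges $e$. (iii) There are a vertex $x_0\in\mathcal{V}$ and a sequence $\{x_n\}\subset\mathcal{V}$ with $d(x_n,x_0)\to+\infty$. (iv) For every $R>0$ the ball $B_R(x_0)$ is finite, consisting of finitely many vertices and edges. (v) There is $C>0$ with $\sum_{y\sim x}\omega(x,y)\le C\mu_{\mathcal{V}}(x)$ for every $x\in\mathcal{V}$. (vi) $j:=\sup_e l_e<\infty$ and $r:=\inf_e l_e>0$. *)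

(* Defs.v *)
From HB Require Import structures.
From mathcomp Require Import all_boot all_order all_algebra.
From mathcomp Require Import all_classical all_reals all_analysis.

Set Implicit Arguments.
Unset Strict Implicit.
Unset Printing Implicit Defensive.

Import Order.TTheory GRing.Theory Num.Theory.
Import numFieldNormedType.Exports.

Local Open Scope classical_set_scope.
Local Open Scope ring_scope.

(* Edge lengths are taken to be real, so that [l e < +oo] is built in. *)
Record metric_graph (R : realType) := MetricGraph {
  vertex : countType;
  edge : countType;
  ini : edge -> vertex;
  fin : edge -> vertex;
  len : edge -> R;
  len_gt0 : forall e, 0 < len e }.

(* The points of the graph: vertices and interior points of edges. A function
   on [gpoint G] has one value at each vertex, so that the functions of class
   F_0 are exactly the functions [gpoint G -> R]. *)
Inductive gpoint (R : realType) (G : metric_graph R) : Type :=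
| Vtx of vertex G
| Pt (e : edge G) (t : R) of 0 < t < len e.

Arguments Vtx {R G} _.
Arguments Pt {R G} e t _.

Section MetricGraph.
Context (R : realType) (G : metric_graph R).
Implicit Types (e : edge G) (v x y : vertex G) (f u V : gpoint G -> R).

(* The parametrization of the closed edge e by [0, l_e]; it is extended to
   the whole line by the constants i(e) and j(e). *)
Definition loc e (t : R) : gpoint G :=
  match @idP (0 < t < len e) with
  | ReflectT h => Pt e t h
  | ReflectF _ => if t <= 0 then Vtx (ini e) else Vtx (fin e)
  end.

Definition restr f e : R -> R := fun t => f (loc e t).

Definition incident e v : Prop := v = ini e \/ v = fin e.

Definition neighbor x y : Prop :=
  exists e, (x = ini e /\ y = fin e) \/ (x = fin e /\ y = ini e).

(* [path_length p q L]: a path from p to q has length L. Each step joins two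
   points of the same closed edge, along that edge. *)
Inductive path_length : gpoint G -> gpoint G -> R -> Prop :=
| path_nil p : path_length p p 0
| path_step e (s t : R) q L :
    0 <= s <= len e -> 0 <= t <= len e ->
    path_length (loc e t) q L ->
    path_length (loc e s) q (`|s - t| + L).

(* Real-valued infimum: meaningful as soon as p and q are joined by a path,
   hence everywhere on a connected graph. *)
Definition gdist (p q : gpoint G) : R := inf [set L | path_length p q L].

Definition gball (x0 : vertex G) (r : R) : set (gpoint G) :=
  [set p | gdist p (Vtx x0) < r].

Definition gball_compl (x0 : vertex G) (r : R) : set (gpoint G) :=
  [set p | r <= gdist p (Vtx x0)].

Definition vertices_in (A : set (gpoint G)) : set (vertex G) :=
  [set x | A (Vtx x)].

Definition edges_meeting (A : set (gpoint G)) : set (edge G) :=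
  [set e | exists t (h : 0 < t < len e), A (Pt e t h)].

Definition infinite_graph : Prop :=
  ~ (finite_set [set: vertex G] /\ finite_set [set: edge G]).

Definition connected_graph : Prop :=
  forall p q : gpoint G, exists L, path_length p q L.

Definition locally_finite : Prop :=
  forall v, finite_set [set e | incident e v].

Definition no_loops : Prop := forall e, ini e <> fin e.

Definition unbounded_from (x0 : vertex G) : Prop :=
  exists xs : nat -> vertex G,
    gdist (Vtx (xs n)) (Vtx x0) @[n --> \oo] --> +oo.

Definition finite_balls (x0 : vertex G) : Prop :=
  forall r : R, 0 < r ->
    finite_set (vertices_in (gball x0 r)) /\
    finite_set (edges_meeting (gball x0 r)).

Definition bounded_weighted_degree (mu : vertex G -> R)
    (omega : vertex G -> vertex G -> R) : Prop :=
  exists2 C : R, 0 < C &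
    forall x, \sum_(y \in [set y | neighbor y x]) omega x y <= C * mu x.

Definition len_sup : R := sup (range (@len R G)).

Definition len_inf : R := inf (range (@len R G)).

Definition bounded_lengths : Prop :=
  has_ubound (range (@len R G)) /\ 0 < len_inf.

Definition base_radius : R := Num.max (2 * len_sup) 1.

(* The weighted space L^1 with weight exp(- alpha d(., x0)). *)
Definition X_space (mu : vertex G -> R) (x0 : vertex G) (alpha : R) :
    set (gpoint G -> R) :=
  [set f | (forall e, measurable_fun `[0, len e] (restr f e)) /\
    (\esum_(x in [set: vertex G])
        (mu x * `|f (Vtx x)| * expR (- alpha * gdist (Vtx x) (Vtx x0)))%:E +
     \esum_(e in [set: edge G])
        \int[lebesgue_measure]_(t in `[0%R, len e])
          (`|restr f e t| * expR (- alpha * gdist (loc e t) (Vtx x0)))%:E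
     < +oo)%E].

Definition right_derivative (g : R -> R) (a : R) : R :=
  lim ((g t - g a) / (t - a) @[t --> a^'+]).

Definition left_derivative (g : R -> R) (a : R) : R :=
  lim ((g t - g a) / (t - a) @[t --> a^'-]).

(* The derivative of g on [a, b], one-sided at the endpoints. *)
Definition closed_derivative (g : R -> R) (a b t : R) : R :=
  if t == a then right_derivative g a
  else if t == b then left_derivative g b
  else derive1 g t.

Definition C1_closed (g : R -> R) (a b : R) : Prop :=
  [/\ forall t, a < t < b -> derivable g t 1,
      cvg ((g t - g a) / (t - a) @[t --> a^'+]),
      cvg ((g t - g b) / (t - b) @[t --> b^'-]) &
      {within `[a, b], continuous (closed_derivative g a b)}].

Definition C2_open (g : R -> R) (a b : R) : Prop :=
  forall t, a < t < b ->
    [/\ derivable g t 1, derivable (derive1 g) t 1 & {for t, continuous (derive1n 2 g)}].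

Definition continuous_on_graph f : Prop :=
  forall e, {within `[0, len e], continuous (restr f e)}.

Definition D_space : set (gpoint G -> R) :=
  [set f | continuous_on_graph f /\
    forall e, [/\ C2_open (restr f e) 0 (len e),
      C1_closed (restr f e) 0 (len e) &
      derive1n 2 (restr f e) \_ `]0, len e[
        \in Lfun (@lebesgue_measure R) +oo%E]].

Definition normal_derivative f e v : R :=
  if v == fin e then left_derivative (restr f e) (len e)
  else - right_derivative (restr f e) 0.

Definition kirchhoff f v : R :=
  \sum_(e \in [set e | incident e v]) normal_derivative f e v.

(* The weight enters only through its values on pairs of neighbors. *)
Definition vertex_laplacian (mu : vertex G -> R)
    (omega : vertex G -> vertex G -> R) f x : R :=
  (mu x)^-1 *
  \sum_(y \in [set y | neighbor y x]) omega x y * (f (Vtx y) - f (Vtx x)).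

Definition edge_laplacian f e (t : R) : R := derive1n 2 (restr f e) t.

Definition is_solution (mu : vertex G -> R)
    (omega : vertex G -> vertex G -> R) (sigma : R) V u : Prop :=
  [/\ D_space u,
      forall e t, 0 < t < len e ->
        edge_laplacian u e t + restr V e t * `|restr u e t| `^ sigma <= 0,
      forall x, vertex_laplacian mu omega u x
        + V (Vtx x) * `|u (Vtx x)| `^ sigma <= 0 &
      forall x, kirchhoff u x = 0].

End MetricGraph.

Arguments infinite_graph {R} G.
Arguments connected_graph {R} G.
Arguments locally_finite {R} G.
Arguments no_loops {R} G.
Arguments bounded_lengths {R} G.
Arguments len_sup {R} G.
Arguments len_inf {R} G.
Arguments base_radius {R} G.

(* Main.v *)
Require Import Defs.
From HB Require Import structures.
From mathcomp Require Import all_boot all_order all_algebra.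
From mathcomp Require Import all_classical all_reals all_analysis.
From mathcomp Require Import finmap ring lra.

Set Implicit Arguments.
Unset Strict Implicit.
Unset Printing Implicit Defensive.

Import Order.TTheory GRing.Theory Num.Theory.
Import numFieldNormedType.Exports.

Local Open Scope classical_set_scope.
Local Open Scope ring_scope.

(** The vertices and the edges are treated one after the other.

    On the vertices [u] solves the discrete inequality
    [mu x * Delta u x + mu x * V x * |u x|^sigma <= 0]. Summing it against a
    weight [phi >= 0] and moving the differences onto [phi] gives
    [sum mu V |u|^sigma phi <= sum |u| D phi], where [D phi x] is the sum of
    [omega x y * |phi y - phi x|] over the neighbors [y] of [x]
    ([esum_test_le]). For [phi = exp (- g)], with [g] a function of the distance
    [d] to [x0], the bound on the lengths of the edges makes [g] vary by a
    bounded amount [k] between neighbors, and the bound on the weighted degree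
    gives [D phi <= c * k * exp k * mu * phi] ([variation_exp_le]). Young's
    inequality then splits [|u| D phi] into a multiple of [mu V |u|^sigma phi],
    to be absorbed, and a multiple of [mu V^(-1/(sigma-1)) phi], which the
    hypothesis on [V] controls ([energy_le]).

    This is used with two families of weights. With
    [phi = exp (- max (alpha d, A d - m))], where [A = delta / r1] and
    [alpha = delta / r <= A], the sums converge because [u] lies in the weighted
    space of exponent [A]; the resulting bound does not depend on [m], so
    letting [m] grow shows that [u] lies in the weighted spaces of all exponents
    [delta / r] with [r >= r1] ([summable_slower_weight]). With [phi = 1] up to
    distance [r + j] and [phi = exp (- alpha (d - r - j))] beyond it,
    [alpha = delta / r], the variation of [phi] lives where [d >= r] and is
    [O(1/r)] times [mu phi]; the power of [r] lost in Young's inequality is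
    exactly the growth allowed for the sums of [V^(-1/(sigma-1))]. Hence, for
    every [lam > 0], the total energy [sum mu V |u|^sigma phi] is at most
    [lam] times its part on [d >= r], plus [K lam^(-1/(sigma-1))] with [K]
    independent of [r] ([cutoff_energy]). With [lam = 1/2] the energy is finite,
    so its tails vanish; [r] and then [lam] going to infinity make it zero, and
    [u = 0] on the vertices ([vertex_liouville]).

    On an edge, [u'' <= - V |u|^sigma <= 0] makes [u] concave, and [u] now
    vanishes at both ends. Hence [u >= 0] there and all the outward derivatives
    at the vertices are nonpositive; as they add up to zero at each vertex, they
    are all zero. A concave function that starts from [0] with slope [0] stays
    nonpositive, so [u = 0] on the edge ([concave_eq0]). *)

(** * Summation by parts on the vertices *)

Section TestFunctions.
Context (R : realType) (T : choiceType).
Context (nb : T -> T -> Prop) (om : T -> T -> R).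
Hypothesis nb_sym : forall x y, nb x y -> nb y x.
Hypothesis nb_fin : forall x, finite_set [set y | nb y x].
Hypothesis om_sym : forall x y, om x y = om y x.
Hypothesis om_ge0 : forall x y, nb y x -> 0 <= om x y.

Definition variation (phi : T -> R) (x : T) : R :=
  \sum_(y \in [set y | nb y x]) om x y * `|phi y - phi x|.

Lemma variation_ge0 phi x : 0 <= variation phi x.
Proof. by apply: fsumr_ge0 => y /om_ge0 h; rewrite mulr_ge0. Qed.

(** The double sum of [om x y * (phi x * u y - u x * phi y)] over the finite set
    [N] vanishes by symmetry, which trades the differences of [u] for those of
    [phi]. The set [N] has to contain the support of [phi] together with the
    neighbors of the support, so that the sums in the
    inequality for [u] are complete. *)
Lemma test_finite_support (u h phi : T -> R) (N : {fset T}) :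
  (forall x,
    \sum_(y \in [set y | nb y x]) om x y * (u y - u x) + h x <= 0) ->
  (forall x, 0 <= phi x) ->
  (forall x, phi x != 0 -> x \in N /\ [set y | nb y x] `<=` [set` N]) ->
  \sum_(x <- N) h x * phi x <= \sum_(x <- N) `|u x| * variation phi x.
Proof.
move=> hu phi0 phiN.
pose a x y := if y \in [set y | nb y x] then om x y else 0.
have a_sym x y : a x y = a y x.
  rewrite /a om_sym; congr (if _ then _ else _).
  by apply/idP/idP => /set_mem/= /nb_sym ?; exact/mem_set.
have a_ge0 x y : 0 <= a x y by rewrite /a; case: ifP => // /set_mem /om_ge0.
have sumN x g : \sum_(y <- N) a x y * g y =
    \sum_(y \in [set y | nb y x] `&` [set` N]) om x y * g y.
  rewrite fsbig_seq// setIC fsbig_mkcondr; apply: eq_fsbigr => y _.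
  by rewrite /a; case: ifP => // _; rewrite mul0r.
have sym0 : \sum_(x <- N) \sum_(y <- N)
   (a x y * phi x * (u y - u x) - a x y * u x * (phi y - phi x)) = 0.
  transitivity (\sum_(x <- N) \sum_(y <- N) a x y * phi x * u y -
      \sum_(x <- N) \sum_(y <- N) a x y * u x * phi y).
    rewrite -sumrB; apply: eq_bigr => x _; rewrite -sumrB.
    by apply: eq_bigr => y _; ring.
  apply/eqP; rewrite subr_eq0; apply/eqP; rewrite exchange_big.
  by apply: eq_bigr => x _; apply: eq_bigr => y _; rewrite a_sym; ring.
rewrite -[leRHS]subr0 -[X in _ - X]sym0 -sumrB; apply: ler_sum => x _.
rewrite sumrB opprB addrCA.
have -> : \sum_(y <- N) a x y * phi x * (u y - u x) =
    phi x * \sum_(y <- N) a x y * (u y - u x).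
  by rewrite big_distrr; apply: eq_bigr => y _; rewrite /=; ring.
have h1 : h x * phi x <= - (phi x * \sum_(y <- N) a x y * (u y - u x)).
  have [->|px] := eqVneq (phi x) 0; first by rewrite mulr0 mul0r oppr0.
  rewrite sumN setIidl; last by have [] := phiN _ px.
  rewrite mulrC -mulrN ler_wpM2l//.
  by have := hu x; lra.
have h2 : - \sum_(y <- N) a x y * u x * (phi y - phi x) <= `|u x| * variation phi x.
  apply: (@le_trans _ _ (`|u x| * \sum_(y <- N) a x y * `|phi y - phi x|)).
    rewrite big_distrr/= -sumrN; apply: ler_sum => y _.
    rewrite [leRHS]mulrCA -mulrA -mulrN ler_wpM2l// -normrM.
    by rewrite -normrN ler_norm.
  rewrite ler_wpM2l// sumN /variation [leRHS](fsbigID [set` N])//= lerDl.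
  by apply: fsumr_ge0 => y [/om_ge0 ? _]; rewrite mulr_ge0.
by lra.
Qed.

(** The truncations [max (phi - eps) 0] have finite support, and truncating is a
    contraction: it does not increase the variation of [phi], so the bound is
    uniform in [eps]. *)
Lemma esum_test_le (u h phi : T -> R) :
  (forall x,
    \sum_(y \in [set y | nb y x]) om x y * (u y - u x) + h x <= 0) ->
  (forall x, 0 <= h x) -> (forall x, 0 <= phi x) ->
  (forall eps, 0 < eps -> finite_set [set x | eps < phi x]) ->
  (\esum_(x in setT) (h x * phi x)%:E <=
   \esum_(x in setT) (`|u x| * variation phi x)%:E)%E.
Proof.
move=> hu h0 phi0 phi_fin.
have v0 x : 0 <= `|u x| * variation phi x by rewrite mulr_ge0 ?variation_ge0.
apply: ge_ereal_sup => _ [F [finF _] <-].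
rewrite fsumEFin//; set M := \sum_(x \in F) h x.
have M0 : 0 <= M by apply: fsumr_ge0.
apply/lee_addgt0Pr => e e0.
(* Truncating at eps costs at most eps * M on F. *)
pose eps := e / (M + 1).
have eps0 : 0 < eps by rewrite divr_gt0// ltr_wpDl.
have epsM : eps * M <= e.
  by rewrite /eps mulrAC -mulrA ler_piMr ?(ltW e0)// ler_pdivrMr; lra.
pose phie x := Num.max (phi x - eps) 0.
pose K := [set x | eps < phi x].
pose S := (F `|` K) `|` \bigcup_(x in K) [set y | nb y x].
have finK : finite_set K by exact: phi_fin.
have finS : finite_set S.
  rewrite finite_setU; split; first by rewrite finite_setU.
  exact: bigcup_finite.
have phie0 x : 0 <= phie x by rewrite le_max lexx orbT.
have step : \sum_(x <- fset_set S) h x * phie x <=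
    \sum_(x <- fset_set S) `|u x| * variation phie x.
  apply: test_finite_support => // x px.
  have Kx : K x.
    move: px; rewrite /phie /K/=; case: (leP (phi x - eps) 0) => /=.
      by rewrite eqxx.
    by rewrite subr_gt0.
  split; first by rewrite in_fset_set//; apply/mem_set; left; right.
  by move=> y ny /=; rewrite in_fset_set//; apply/mem_set; right; exists x.
have phieD x : phi x <= phie x + eps.
  by rewrite -lerBlDr le_max lexx.
have lipe x y : `|phie y - phie x| <= `|phi y - phi x|.
  rewrite /phie; have := ler_norm (phi y - phi x).
  have := ler_norm (- (phi y - phi x)); rewrite normrN ler_norml.
  by case: (leP (phi x - eps) 0); case: (leP (phi y - eps) 0) => /=; lra.
have : \sum_(x \in F) h x * phi x <=
    \sum_(x <- fset_set S) `|u x| * variation phi x + e.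
  apply: (@le_trans _ _ (\sum_(x \in F) (h x * phie x + eps * h x))).
    rewrite !fsbig_finite//; apply: ler_sum => x _.
    by rewrite (mulrC eps) -mulrDr ler_wpM2l.
  rewrite fsbig_split//= -mulr_fsumr lerD//.
  apply: (@le_trans _ _ (\sum_(x <- fset_set S) h x * phie x)).
    rewrite -fsbig_finite// [leRHS](fsbigID F)//= setIidr.
      by rewrite lerDl; apply: fsumr_ge0 => x _; rewrite mulr_ge0.
    by move=> x Fx; left; left.
  apply: (le_trans step); apply: ler_sum => x _.
  rewrite ler_wpM2l// /variation !fsbig_finite//.
  rewrite [leLHS]big_seq [leRHS]big_seq; apply: ler_sum => y.
  rewrite in_fset_set// => /set_mem/om_ge0 oy.
  by rewrite ler_wpM2l.
rewrite -lee_fin => /le_trans -> //.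
rewrite EFinD leeD2r//; apply: esum_ge; exists S; first by split.
by rewrite fsumEFin// fsbig_finite.
Qed.

End TestFunctions.

(** * Elementary inequalities *)

Section Inequalities.
Context (R : realType).

Lemma ler_dist_max (a b c e k : R) :
  `|a - b| <= k -> `|c - e| <= k -> `|Num.max a c - Num.max b e| <= k.
Proof.
rewrite !ler_norml => /andP[? ?] /andP[? ?].
by case: (leP a c); case: (leP b e) => ? ?; lra.
Qed.

Lemma expRN_dist_le (s t k : R) : `|s - t| <= k ->
  `|expR (- t) - expR (- s)| <= k * expR k * expR (- s).
Proof.
move=> stk; have k0 : 0 <= k by rewrite (le_trans _ stk).
have -> : - t = (s - t) + - s by ring.
rewrite expRD -[X in `|_ - X|]mul1r -mulrBl normrM (ger0_norm (expR_ge0 _)).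
rewrite ler_wpM2r ?expR_ge0//; move: stk; set z := s - t.
rewrite ler_norml => /andP[kz zk].
have ek1 : 1 <= expR k by rewrite -expR0 ler_expR.
have kek : k <= k * expR k by rewrite ler_peMr.
have /= z1 := expR_ge1Dx z; have /= z2 := expR_ge1Dx (- z).
have ez : expR z - 1 <= z * expR z.
  have : (1 - z) * expR z <= expR (- z) * expR z by rewrite ler_wpM2r ?expR_ge0.
  by rewrite -expRD addNr expR0; lra.
have zz : z * expR z <= k * expR k.
  have [z0|z0] := leP 0 z; first by rewrite ler_pM ?expR_ge0// ler_expR.
  by rewrite (@le_trans _ _ 0)//; [rewrite nmulr_rle0 ?expR_ge0|lra].
by rewrite ler_norml; apply/andP; split; lra.
Qed.

(** Young's inequality without its sharp constants: the first term on the right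
    suffices when [a <= lam * v * t `^ (sigma - 1)]; otherwise the failure
    of that inequality bounds [t] from above and the second term suffices. *)
Lemma young_weighted (sigma a t v lam : R) : 1 < sigma ->
  0 <= a -> 0 <= t -> 0 < v -> 0 < lam ->
  a * t <= lam * (v * t `^ sigma) +
    lam `^ (- (1 / (sigma - 1))) *
      (a `^ (sigma / (sigma - 1)) * v `^ (- (1 / (sigma - 1)))).
Proof.
move=> s1 a0 t0 v0 l0; set q := 1 / (sigma - 1).
have s10 : 0 < sigma - 1 by rewrite subr_gt0.
have q0 : 0 < q by rewrite divr_gt0.
have sq : sigma / (sigma - 1) = 1 + q by rewrite /q; field; lra.
have r0 : 0 <= lam `^ (- q) * (a `^ (sigma / (sigma - 1)) * v `^ (- q)).
  by rewrite !mulr_ge0 ?powR_ge0.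
have l1 : 0 <= lam * (v * t `^ sigma) by rewrite !mulr_ge0 ?powR_ge0 ?ltW.
have [->|tn0] := eqVneq t 0; first by rewrite mulr0 addr_ge0// ?mulr_ge0 ?powR_ge0 ?ltW.
have t_gt0 : 0 < t by rewrite lt_neqAle eq_sym tn0.
have [ha|ha] := leP a (lam * v * t `^ (sigma - 1)).
  rewrite -[leLHS]addr0 lerD//.
  apply: (le_trans (ler_wpM2r t0 ha)).
  by rewrite -!mulrA -[X in _ * (_ * (_ * X))]powRr1// -powRD ?tn0 ?implybT// subrK.
have a_gt0 : 0 < a by rewrite (le_lt_trans _ ha)// !mulr_ge0 ?powR_ge0 ?ltW.
rewrite -[leLHS]add0r lerD//.
rewrite sq powRD ?(gt_eqF a_gt0) ?implybT// powRr1//.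
rewrite mulrCA -!mulrA ler_wpM2l//.
have -> : a `^ q * (lam `^ (- q) * v `^ (- q)) = (a / (lam * v)) `^ q.
  have lv0 : 0 <= lam * v by rewrite mulr_ge0// ltW.
  rewrite -(powRM _ (ltW l0) (ltW v0)) (@powRM _ a)// ?invr_ge0//.
  by rewrite -(powR_inv1 lv0) -powRrM mulN1r.
have {1}-> : t = (t `^ (sigma - 1)) `^ q.
  by rewrite -powRrM /q mulrC divfK ?gt_eqF// powRr1.
rewrite ge0_ler_powR ?nnegrE ?powR_ge0 ?divr_ge0 ?mulr_ge0//; try exact: ltW.
by apply: ltW; rewrite ltr_pdivlMr ?mulr_gt0// mulrC.
Qed.

Lemma absorb_half (I : \bar R) (B : R) : (0 <= I)%E -> (I < +oo)%E ->
  (I <= (1 / 2)%:E * I + B%:E)%E -> (I <= (2 * B)%:E)%E.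
Proof.
by case: I => [x||]// _ _; rewrite -EFinM -EFinD !lee_fin => ?; lra.
Qed.

Lemma le_esumZl (T : choiceType) (P : set T) (c : R) (f : T -> R) : 0 <= c ->
  (forall x, 0 <= f x) ->
  (\esum_(x in P) (c * f x)%:E <= c%:E * \esum_(x in P) (f x)%:E)%E.
Proof.
move=> c0 f0; apply: ge_ereal_sup => _ [F [finF FP] <-].
rewrite fsumEFin// -mulr_fsumr EFinM lee_wpmul2l ?lee_fin//.
by apply: esum_ge; exists F => //; rewrite fsumEFin.
Qed.

End Inequalities.

(** * The Liouville property on the vertices *)

Section VertexLiouville.
Context (R : realType) (T : choiceType).
Context (nb : T -> T -> Prop) (om : T -> T -> R) (mu V d : T -> R).
Context (c j sigma : R).
Hypothesis nb_sym : forall x y, nb x y -> nb y x.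
Hypothesis nb_fin : forall x, finite_set [set y | nb y x].
Hypothesis om_sym : forall x y, om x y = om y x.
Hypothesis om_ge0 : forall x y, nb y x -> 0 <= om x y.
Hypothesis mu_gt0 : forall x, 0 < mu x.
Hypothesis V_gt0 : forall x, 0 < V x.
Hypothesis c_ge0 : 0 <= c.
Hypothesis om_deg : forall x, \sum_(y \in [set y | nb y x]) om x y <= c * mu x.
Hypothesis j_ge0 : 0 <= j.
Hypothesis d_ge0 : forall x, 0 <= d x.
Hypothesis d_lip : forall x y, nb y x -> `|d x - d y| <= j.
Hypothesis d_fin : forall r, finite_set [set x | d x < r].
Hypothesis sigma_gt1 : 1 < sigma.

Lemma variation_exp_le (g : T -> R) (k : R) x : 0 <= k ->
  (forall y, nb y x -> `|g x - g y| <= k) ->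
  variation nb om (fun y => expR (- g y)) x <=
    k * expR k * c * (mu x * expR (- g x)).
Proof.
move=> k0 hg.
have kg : 0 <= k * expR k * expR (- g x) by rewrite !mulr_ge0 ?expR_ge0.
have -> : k * expR k * c * (mu x * expR (- g x)) =
  k * expR k * expR (- g x) * (c * mu x) by ring.
apply: le_trans (ler_wpM2l kg (om_deg x)); rewrite mulr_fsumr.
rewrite /variation !fsbig_finite// [leLHS]big_seq [leRHS]big_seq.
apply: ler_sum => y; rewrite in_fset_set// => /set_mem/= ny.
by rewrite mulrC ler_wpM2r ?om_ge0// expRN_dist_le// hg.
Qed.

Lemma finite_superlevel (g : T -> R) (a m : R) : 0 < a ->
  (forall x, a * d x - m <= g x) ->
  forall eps, 0 < eps -> finite_set [set x | eps < expR (- g x)].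
Proof.
move=> a0 hg eps e0; apply: sub_finite_set (d_fin ((m - ln eps) / a)) => x /=.
rewrite -[X in X < _](lnK e0) ltr_expR => hx.
by rewrite ltr_pdivlMr// mulrC; have := hg x; lra.
Qed.

Context (u : T -> R).
Hypothesis hu : forall x, \sum_(y \in [set y | nb y x]) om x y * (u y - u x)
  + mu x * (V x * `|u x| `^ sigma) <= 0.

(** The energy density, and the density that enters the hypothesis on V. *)
Let w x := mu x * (V x * `|u x| `^ sigma).
Let z x := mu x * V x `^ (- (1 / (sigma - 1))).

Let w_ge0 x : 0 <= w x.
Proof. by rewrite !mulr_ge0 ?powR_ge0 ?ltW. Qed.

Let z_ge0 x : 0 <= z x.
Proof. by rewrite !mulr_ge0 ?powR_ge0 ?ltW. Qed.

Let esum_w_le (phi : T -> R) : (forall x, 0 <= phi x) ->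
  (forall eps, 0 < eps -> finite_set [set x | eps < phi x]) ->
  (\esum_(x in setT) (w x * phi x)%:E <=
   \esum_(x in setT) (`|u x| * variation nb om phi x)%:E)%E.
Proof. by move=> *; exact: esum_test_le. Qed.

Lemma energy_fin (phi : T -> R) (a : R) : 0 <= a -> (forall x, 0 <= phi x) ->
  (forall eps, 0 < eps -> finite_set [set x | eps < phi x]) ->
  (forall x, variation nb om phi x <= a * (mu x * phi x)) ->
  (\esum_(x in setT) (mu x * `|u x| * phi x)%:E < +oo)%E ->
  (\esum_(x in setT) (w x * phi x)%:E < +oo)%E.
Proof.
move=> a0 phi0 phi_fin hvar Xfin.
apply: le_lt_trans (esum_w_le phi0 phi_fin) _.
apply: (@le_lt_trans _ _
  (\esum_(x in setT) (a * (mu x * `|u x| * phi x))%:E)%E).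
  apply: le_esum => x _; rewrite lee_fin.
  have -> : a * (mu x * `|u x| * phi x) = `|u x| * (a * (mu x * phi x)) by ring.
  by rewrite ler_wpM2l.
have Y0 x : 0 <= mu x * `|u x| * phi x by rewrite !mulr_ge0// ltW.
apply: le_lt_trans (le_esumZl _ a0 Y0) _.
by apply: lte_mul_pinfty => //; rewrite lee_fin.
Qed.

(** Only the points of [P], where [phi] varies, contribute to the right-hand
    side; [lam] is left free, since it is 1/2 when the energy has to be absorbed
    and tends to infinity once the tails of the energy are known to vanish. *)
Lemma energy_le (phi : T -> R) (P : set T) (a lam : R) :
  0 <= a -> 0 < lam -> (forall x, 0 <= phi x) ->
  (forall eps, 0 < eps -> finite_set [set x | eps < phi x]) ->
  (forall x, variation nb om phi x <= a * (mu x * phi x)) ->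
  (forall x, ~ P x -> variation nb om phi x = 0) ->
  (\esum_(x in setT) (w x * phi x)%:E <=
   lam%:E * (\esum_(x in P) (w x * phi x)%:E) +
   (lam `^ (- (1 / (sigma - 1))) * a `^ (sigma / (sigma - 1)))%:E *
     \esum_(x in P) (z x * phi x)%:E)%E.
Proof.
move=> a0 l0 phi0 phi_fin hvar hP.
apply: le_trans (esum_w_le phi0 phi_fin) _.
set b := _ * a `^ _.
have b0 : 0 <= b by rewrite mulr_ge0 ?powR_ge0.
have wphi x : 0 <= w x * phi x by rewrite mulr_ge0.
have zphi x : 0 <= z x * phi x by rewrite mulr_ge0.
apply: le_trans (leeD (le_esumZl _ (ltW l0) wphi) (le_esumZl _ b0 zphi)).
rewrite -esumD; first last.
- by move=> x _; rewrite lee_fin mulr_ge0.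
- by move=> x _; rewrite lee_fin mulr_ge0// ltW.
rewrite [leRHS]esum_mkcond; apply: le_esum => x _.
case: ifPn => [_|/negP nP]; last first.
  by rewrite hP ?mulr0// => Px; apply: nP; exact/mem_set.
rewrite -EFinD lee_fin.
apply: (@le_trans _ _ (mu x * phi x * (a * `|u x|))).
  have -> : mu x * phi x * (a * `|u x|) = `|u x| * (a * (mu x * phi x)) by ring.
  by rewrite ler_wpM2l.
apply: le_trans (ler_wpM2l _ (young_weighted sigma_gt1 a0 (normr_ge0 (u x)) (V_gt0 x) l0)) _.
  by rewrite mulr_ge0// ltW.
by rewrite /w /z /b le_eqVlt; apply/orP; left; apply/eqP; ring.
Qed.

Context (delta C r0 r1 : R).
Hypothesis delta_gt0 : 0 < delta.
Hypothesis C_ge0 : 0 <= C.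
Hypothesis r0_gt0 : 0 < r0.
Hypothesis j_le_r0 : j <= r0.
Hypothesis hV : forall r, r0 <= r ->
  (\esum_(x in [set x | (r <= d x)%R]) (z x * expR (- (delta / r * d x)))%:E
    <= (C * r `^ (sigma / (sigma - 1)))%:E)%E.
Hypothesis r0_le_r1 : r0 <= r1.
Hypothesis hX : (\esum_(x in setT)
  (mu x * `|u x| * expR (- (delta / r1 * d x)))%:E < +oo)%E.

(** The ball of radius [r] is finite, and [hV] bounds the rest of the sum. *)
Let z_fin r : r0 <= r ->
  (\esum_(x in setT) (z x * expR (- (delta / r * d x)))%:E < +oo)%E.
Proof.
move=> r0r; rewrite (esumID [set x | r <= d x]); last first.
  by move=> x _; rewrite lee_fin mulr_ge0 ?expR_ge0.
rewrite !setTI lte_add_pinfty//.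
  by apply: le_lt_trans (hV r0r) _; rewrite ltry.
have fin : finite_set (~` [set x | r <= d x]).
  apply: sub_finite_set (d_fin r) => x /=.
  by rewrite ltNge => /negP.
rewrite esum_fset//; last by move=> x _; rewrite lee_fin mulr_ge0 ?expR_ge0.
by rewrite fsumEFin// ltry.
Qed.

(** Summability for the single exponent [delta / r1] improves to every smaller
    [al = delta / r]. The weights [phi m = exp (- max (al d, A d - m))] bridge
    the two: they decay like [exp (- A d)] at infinity, so that their energy is
    finite and can be absorbed, and they increase to [exp (- al d)] with [m],
    while the bound on the energy only involves [V]. *)
Lemma summable_slower_weight r : r1 <= r ->
  (\esum_(x in setT) (mu x * `|u x| * expR (- (delta / r * d x)))%:E < +oo)%E.
Proof.
move=> r1r; set al := delta / r; set A := delta / r1.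
have r1_gt0 : 0 < r1 by exact: lt_le_trans r0_le_r1.
have r_gt0 : 0 < r by exact: lt_le_trans r1r.
have al_gt0 : 0 < al by rewrite divr_gt0.
have alA : al <= A by rewrite ler_wpM2l ?(ltW delta_gt0)// lef_pV2.
have A_gt0 : 0 < A by rewrite divr_gt0.
pose k := A * j.
have k_ge0 : 0 <= k by rewrite mulr_ge0// ltW.
pose a := k * expR k * c.
have a_ge0 : 0 <= a by apply: mulr_ge0 => //; rewrite mulr_ge0 ?expR_ge0.
pose g m x := Num.max (al * d x) (A * d x - m).
pose phi m x := expR (- g m x).
have phi_ge0 m x : 0 <= phi m x by rewrite expR_ge0.
have phi_fin m : forall eps, 0 < eps -> finite_set [set x | eps < phi m x].
  apply: (@finite_superlevel (g m) al 0) => // x.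
  by rewrite subr0 /g le_max lexx.
have phi_var m x : variation nb om (phi m) x <= a * (mu x * phi m x).
  apply: variation_exp_le => // y /d_lip dxy.
  apply: ler_dist_max.
    rewrite -mulrBr normrM gtr0_norm// /k.
    by apply: ler_pM => //; exact: ltW.
  have -> : A * d x - m - (A * d y - m) = A * (d x - d y) by ring.
  by rewrite normrM gtr0_norm// ler_wpM2l// ltW.
have phi_al m x : phi m x <= expR (- (al * d x)).
  by rewrite ler_expR lerN2 /g le_max lexx.
have [Z hZ] : exists Z, \esum_(x in setT) (z x * expR (- (al * d x)))%:E = Z%:E.
  exists (fine (\esum_(x in setT) (z x * expR (- (al * d x)))%:E)%E).
  rewrite fineK// ge0_fin_numE ?z_fin//; first exact: le_trans r1r.
  by apply: esum_ge0 => x _; rewrite lee_fin mulr_ge0 ?expR_ge0.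
pose b := (1 / 2) `^ (- (1 / (sigma - 1))) * a `^ (sigma / (sigma - 1)).
have b_ge0 : 0 <= b by rewrite mulr_ge0 ?powR_ge0.
have energy m : (\esum_(x in setT) (w x * phi m x)%:E <= (2 * (b * Z))%:E)%E.
  apply: absorb_half.
  - by apply: esum_ge0 => x _; rewrite lee_fin mulr_ge0.
  - apply: (energy_fin a_ge0 (phi_ge0 m) (phi_fin m) (phi_var m)); apply: (@le_lt_trans _ _
      (\esum_(x in setT) (expR m * (mu x * `|u x| * expR (- (A * d x))))%:E)%E).
      apply: le_esum => x _; rewrite lee_fin mulrCA ler_wpM2l//.
        by rewrite mulr_ge0// ltW.
      rewrite -expRD ler_expR lerNl opprD opprK addrC /g le_max.
      by rewrite lexx orbT.
    have Y0 x : 0 <= mu x * `|u x| * expR (- (A * d x)).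
      by rewrite !mulr_ge0 ?expR_ge0// ltW.
    apply: le_lt_trans (le_esumZl _ (expR_ge0 m) Y0) _.
    by apply: lte_mul_pinfty => //; rewrite lee_fin expR_ge0.
  - have half_gt0 : 0 < 1 / 2 :> R by lra.
    apply: le_trans (energy_le (P := setT) a_ge0 half_gt0 (phi_ge0 m)
      (phi_fin m) (phi_var m) _) _; first by move=> x; case.
    rewrite leeD2l// -/b [(b * Z)%:E]EFinM -hZ lee_wpmul2l ?lee_fin//.
    by apply: le_esum => x _; rewrite lee_fin ler_wpM2l.
have Wfin : (\esum_(x in setT) (w x * expR (- (al * d x)))%:E <= (2 * (b * Z))%:E)%E.
  apply: ge_ereal_sup => _ [F [finF _] <-].
  (* This m is at least A * d on F, where phi m is therefore exp (- al d). *)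
  pose m := \sum_(x \in F) A * d x.
  apply: le_trans (energy m); apply: esum_ge; exists F => //.
  rewrite !fsumEFin// lee_fin !fsbig_finite// [leLHS]big_seq [leRHS]big_seq.
  apply: ler_sum => x; rewrite in_fset_set// => /set_mem Fx.
  rewrite ler_wpM2l// ler_expR lerN2 /g ge_max lexx/=.
  rewrite (@le_trans _ _ 0)//; last by rewrite mulr_ge0// ltW.
  rewrite subr_le0 /m (fsbigD1 x)//= lerDl.
  by apply: fsumr_ge0 => y _; rewrite mulr_ge0// ltW.
apply: (@le_lt_trans _ _ (\esum_(x in setT)
    ((w x * expR (- (al * d x)))%:E + (z x * expR (- (al * d x)))%:E))%E).
  apply: le_esum => x _; rewrite -EFinD lee_fin -mulrDl ler_wpM2r ?expR_ge0//.
  rewrite /w /z -mulrDr ler_wpM2l ?(ltW (mu_gt0 x))//.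
  have := young_weighted sigma_gt1 ler01 (normr_ge0 (u x)) (V_gt0 x) (@ltr01 R).
  by rewrite !powR1 !mul1r.
rewrite esumD; [|by move=> x _; rewrite lee_fin mulr_ge0 ?expR_ge0..].
by rewrite hZ lte_add_pinfty ?ltry//; apply: le_lt_trans Wfin _; rewrite ltry.
Qed.

(** The constant of [cutoff_energy]. The first factor comes from the variation of
   the cut-off, the factor [exp (2 delta)] from
   [cutoff r <= exp (2 delta - al d)], where [al = delta / r]. *)
Let K := (delta * j * expR delta * c) `^ (sigma / (sigma - 1)) *
  (expR (2 * delta) * C).

(** The cut-off is kept equal to 1 up to r + j rather than r: then a vertex with
   d < r and all its neighbors see the value 1, and the variation is supported
   exactly where hV applies. *)
Let cutoff r x := expR (- Num.max (delta / r * (d x - (r + j))) 0).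

Let cutoff1 r x : 0 < r -> d x <= r + j -> cutoff r x = 1.
Proof.
move=> r_gt0 dx; rewrite /cutoff max_r ?oppr0 ?expR0//.
by rewrite pmulr_rle0 ?divr_gt0// subr_le0.
Qed.

Let cutoff_energy r lam : r1 <= r -> 0 < lam ->
  (\esum_(x in setT) (w x * cutoff r x)%:E < +oo)%E /\
  (\esum_(x in setT) (w x * cutoff r x)%:E <=
   lam%:E * (\esum_(x in [set x | (r <= d x)%R]) (w x * cutoff r x)%:E) +
   (lam `^ (- (1 / (sigma - 1))) * K)%:E)%E.
Proof.
move=> r1r lam_gt0; set al := delta / r.
have r0r : r0 <= r by exact: le_trans r1r.
have r_gt0 : 0 < r by exact: lt_le_trans r0r.
have al_gt0 : 0 < al by rewrite divr_gt0.
have jr : j <= r by exact: le_trans r0r.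
have alr : al * r = delta by rewrite /al divfK ?gt_eqF.
have alj : al * j <= delta by rewrite -alr ler_wpM2l// ltW.
have alj_ge0 : 0 <= al * j by rewrite mulr_ge0// ltW.
pose b := delta * j * expR delta * c.
have b_ge0 : 0 <= b by rewrite !mulr_ge0 ?expR_ge0// ltW.
have phi_ge0 x : 0 <= cutoff r x by rewrite expR_ge0.
have phi_fin eps : 0 < eps -> finite_set [set x | eps < cutoff r x].
  apply: (@finite_superlevel _ al (al * (r + j))) => // x.
  by rewrite -mulrBr le_max lexx.
have phi_var x : variation nb om (cutoff r) x <= b / r * (mu x * cutoff r x).
  apply: le_trans (@variation_exp_le _ (al * j) x alj_ge0 _) _.
    move=> y /d_lip dxy; apply: ler_dist_max; last by rewrite subrr normr0.
    rewrite -mulrBr normrM gtr0_norm// ler_wpM2l ?(ltW al_gt0)//.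
    by rewrite opprB addrA subrK.
  rewrite ler_wpM2r ?mulr_ge0 ?expR_ge0 ?(ltW (mu_gt0 _))//.
  have -> : b / r = al * j * expR delta * c by rewrite /b /al; ring.
  by rewrite ler_wpM2r// ler_wpM2l// ler_expR.
have phi_var0 x : ~ r <= d x -> variation nb om (cutoff r) x = 0.
  move=> /negP; rewrite -ltNge => dx; apply: fsbig1 => y /d_lip.
  rewrite ler_norml => /andP[h _].
  by rewrite !cutoff1// ?subrr ?normr0 ?mulr0//; move: j_ge0; lra.
(* al * (r + j) <= 2 * delta, since al * r = delta and j <= r. *)
have phi_le x : cutoff r x <= expR (2 * delta) * expR (- (al * d x)).
  rewrite -expRD ler_expR lerNl opprD opprK le_max -/al; apply/orP; left.
  by rewrite mulrBr [al * (r + j)]mulrDr alr; lra.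
split.
  have br_ge0 : 0 <= b / r by rewrite divr_ge0// ltW.
  apply: (energy_fin br_ge0 phi_ge0 phi_fin phi_var).
  apply: (@le_lt_trans _ _ (\esum_(x in setT)
      (expR (2 * delta) * (mu x * `|u x| * expR (- (al * d x))))%:E)%E).
    apply: le_esum => x _; rewrite lee_fin mulrCA ler_wpM2l//.
    by rewrite mulr_ge0// ltW.
  have Y0 x : 0 <= mu x * `|u x| * expR (- (al * d x)).
    by rewrite !mulr_ge0 ?expR_ge0// ltW.
  apply: le_lt_trans (le_esumZl _ (expR_ge0 _) Y0) _.
  apply: lte_mul_pinfty; rewrite ?lee_fin ?expR_ge0//.
  exact: summable_slower_weight.
have br_ge0 : 0 <= b / r by rewrite divr_ge0// ltW.
apply: le_trans (energy_le br_ge0 lam_gt0 phi_ge0 phi_fin phi_var phi_var0) _.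
rewrite leeD2l// !EFinM -muleA lee_wpmul2l ?lee_fin ?powR_ge0//.
apply: (@le_trans _ _ (((b / r) `^ (sigma / (sigma - 1)))%:E *
   ((expR (2 * delta))%:E * (C * r `^ (sigma / (sigma - 1)))%:E))%E).
  rewrite lee_wpmul2l ?lee_fin ?powR_ge0//.
  apply: le_trans (lee_wpmul2l _ (hV r0r)); last by rewrite lee_fin expR_ge0.
  apply: le_trans (le_esumZl _ (expR_ge0 _) _); last first.
    by move=> x; rewrite mulr_ge0 ?expR_ge0.
  by apply: le_esum => x _; rewrite lee_fin mulrCA ler_wpM2l.
rewrite -!EFinM lee_fin /K -/b.
(* The powers of r from the slope b / r and from hV cancel. *)
have {2}-> : b = b / r * r by rewrite divfK ?gt_eqF.
rewrite (@powRM _ (b / r)) ?divr_ge0 ?(ltW r_gt0)// le_eqVlt; apply/orP; left; apply/eqP; ring.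
Qed.

Let cutoff_le1 r x : cutoff r x <= 1.
Proof. by rewrite -expR0 ler_expR lerNl oppr0 le_max lexx orbT. Qed.

Let total_energy : (\esum_(x in setT) (w x)%:E < +oo)%E.
Proof.
pose B := 2 * ((1 / 2) `^ (- (1 / (sigma - 1))) * K).
apply: (@le_lt_trans _ _ B%:E); last by rewrite ltry.
apply: ge_ereal_sup => _ [F [finF _] <-].
pose r := r1 + \sum_(x \in F) d x.
have sum0 : 0 <= \sum_(x \in F) d x by exact: fsumr_ge0.
have r1r : r1 <= r by rewrite lerDl.
have r1_gt0 : 0 < r1 by exact: lt_le_trans r0_le_r1.
have r_gt0 : 0 < r by exact: lt_le_trans r1r.
have half_gt0 : 0 < 1 / 2 :> R by lra.
have [Ifin I_le] := cutoff_energy r1r half_gt0.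
have wc x : (0 <= (w x * cutoff r x)%:E)%E by rewrite lee_fin mulr_ge0 ?expR_ge0.
apply: (@le_trans _ _ (\esum_(x in setT) (w x * cutoff r x)%:E)%E).
  apply: esum_ge; exists F => //; rewrite !fsumEFin// lee_fin.
  rewrite !fsbig_finite// [leLHS]big_seq [leRHS]big_seq.
  apply: ler_sum => x; rewrite in_fset_set// => /set_mem Fx.
  rewrite cutoff1 ?mulr1// /r (fsbigD1 x)//=.
  have : 0 <= \sum_(y \in F `\ x) d y by exact: fsumr_ge0.
  by move: j_ge0; lra.
apply: absorb_half => //; first by apply: esum_ge0.
apply: (le_trans I_le); rewrite leeD2r// lee_wpmul2l ?lee_fin ?(ltW half_gt0)//.
by rewrite [leRHS](esumID [set x | r <= d x])// setTI leeDl// esum_ge0.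
Qed.

Let tail_energy x eta : 0 < eta -> exists r, [/\ r1 <= r, d x <= r &
  (\esum_(x in [set x | (r <= d x)%R]) (w x)%:E <= eta%:E)%E].
Proof.
move=> eta_gt0.
have Efin : \esum_(x in setT) (w x)%:E \is a fin_num.
  by rewrite ge0_fin_numE ?total_energy//; apply: esum_ge0 => y _; rewrite lee_fin.
have [_ [F [finF _] <-]] := ub_ereal_sup_adherent eta_gt0 Efin.
rewrite -[ereal_sup _]/(esum setT (fun y => (w y)%:E)) => hF.
pose r := r1 + d x + 1 + \sum_(y \in F) d y.
have sum0 : 0 <= \sum_(y \in F) d y by exact: fsumr_ge0.
have r1_gt0 : 0 < r1 by exact: lt_le_trans r0_le_r1.
exists r; split; [by have := d_ge0 x; rewrite /r; lra|by rewrite /r; lra|].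
have w0 y : setT y -> (0 <= (w y)%:E)%E by rewrite lee_fin.
move: hF; rewrite (@esumID _ _ [set x | r <= d x] setT _ w0) !setTI.
set I1 := (X in (X + _ - _)%E); set I2 := (X in (I1 + X - _)%E) => hF.
have I1_ge0 : (0 <= I1)%E by apply: esum_ge0 => y _; rewrite lee_fin.
have I2_ge0 : (0 <= I2)%E by apply: esum_ge0 => y _; rewrite lee_fin.
have := total_energy; rewrite (@esumID _ _ [set x | r <= d x] setT _ w0) !setTI.
rewrite -/I1 -/I2 => I12.
have FI2 : (\sum_(y \in F) (w y)%:E <= I2)%E.
  apply: esum_ge; exists F => //; split=> // y Fy /=; apply/negP.
  rewrite -ltNge /r (fsbigD1 y)//=.
  have : 0 <= \sum_(y \in F `\ y) d y by exact: fsumr_ge0.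
  by have := d_ge0 x; lra.
move: I1 I2 I1_ge0 I2_ge0 I12 hF FI2 => [i1||] [i2||]// _ _ _.
by rewrite fsumEFin// -!EFinD lte_fin !lee_fin; lra.
Qed.

(** If [d x <= r] then [w x] is at most the energy of [cutoff r]. Choose [lam]
    first, to make the constant term of [cutoff_energy] small, and then [r], to
    make [lam] times the tail of the energy small. *)
Lemma vertex_liouville x : u x = 0.
Proof.
suff : w x <= 0.
  rewrite le_eqVlt ltNge w_ge0 orbF !mulf_eq0 (gt_eqF (mu_gt0 x)) (gt_eqF (V_gt0 x))/=.
  by rewrite powR_eq0 normr_eq0 => /andP[/eqP].
have K_ge0 : 0 <= K by rewrite !mulr_ge0 ?powR_ge0 ?expR_ge0.
apply/ler_addgt0Pr => e e_gt0; rewrite add0r.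
pose b := e / (2 * (K + 1)).
have b_gt0 : 0 < b by rewrite divr_gt0// mulr_gt0//; lra.
pose lam := b `^ (- (sigma - 1)).
have lam_gt0 : 0 < lam by rewrite powR_gt0.
have lamE : lam `^ (- (1 / (sigma - 1))) = b.
  rewrite /lam -powRrM mulrNN mul1r divff ?powRr1 ?ltW//.
  by rewrite gt_eqF// subr_gt0.
have eta_gt0 : 0 < e / 2 / lam by rewrite !divr_gt0.
have [r [r1r dxr tail]] := tail_energy x eta_gt0.
have [_ I_le] := cutoff_energy r1r lam_gt0.
have r1_gt0 : 0 < r1 by exact: lt_le_trans r0_le_r1.
have r_gt0 : 0 < r by exact: lt_le_trans r1r.
have wx : ((w x)%:E <= \esum_(x in setT) (w x * cutoff r x)%:E)%E.
  apply: esum_ge; exists [set x] => //; rewrite fsbig_set1 cutoff1 ?mulr1//.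
  by move: j_ge0; lra.
rewrite -lee_fin; apply: (le_trans wx); apply: (le_trans I_le).
apply: (@le_trans _ _ (lam%:E * (e / 2 / lam)%:E + (b * K)%:E)%E).
  rewrite lamE leeD2r// lee_wpmul2l ?lee_fin ?(ltW lam_gt0)//.
  apply: le_trans tail; apply: le_esum => y _.
  by rewrite lee_fin ler_piMr.
rewrite -EFinM -EFinD lee_fin mulrC divfK ?gt_eqF//.
have bK : b * (K + 1) = e / 2.
  by rewrite /b; field; rewrite ?andbT; lra.
by move: b_gt0 bK; rewrite mulrDr mulr1; lra.
Qed.

End VertexLiouville.

(** * Concave functions on an edge *)

Section ConcaveOnInterval.
Context (R : realType) (g : R -> R) (l : R).
Hypothesis l_gt0 : 0 < l.
Hypothesis g_cont : {within `[0, l], continuous g}.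
Hypothesis g_C2 : C2_open g 0 l.
Hypothesis g_concave : forall t, 0 < t < l -> derive1n 2 g t <= 0.

Lemma concave_slopes a b c : 0 <= a -> a < b -> b < c -> c <= l ->
  (g c - g b) * (b - a) <= (g b - g a) * (c - b).
Proof.
move=> a0 ab bc cl.
have mvt s t : 0 <= s -> s < t -> t <= l ->
    exists2 p, s < p < t & g t - g s = derive1 g p * (t - s).
  move=> s0 st tl; have [p pst||p] := @MVT R g (derive1 g) s t st.
  - have /andP[sp pt] : s < p < t by move: pst; rewrite in_itv.
    have pl : 0 < p < l by rewrite (le_lt_trans s0)//= (lt_le_trans pt).
    have [dg _ _] := g_C2 pl.
    by rewrite derive1E; exact/derivableP.
  - apply: continuous_subspaceW g_cont => x /=; rewrite !in_itv/= => /andP[? ?].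
    by apply/andP; split; lra.
  by rewrite in_itv/= => pst ->; exists p.
have [p /andP[ap pb] ->] := mvt a b a0 ab (ltW (lt_le_trans bc cl)).
have [q /andP[bq qc] ->] := mvt b c (le_trans a0 (ltW ab)) bc cl.
have pq : p < q by lra.
have in0l x : p <= x <= q -> 0 < x < l by move=> /andP[? ?]; apply/andP; split; lra.
have [x xpq||x] := @MVT R (derive1 g) (derive1n 2 g) p q pq.
- have /andP[px xq] : p < x < q by move: xpq; rewrite in_itv.
  have [|_ dg _] := g_C2 (in0l x _); first by rewrite (ltW px) ltW.
  by rewrite derive1nS derive1n1 derive1E; exact/derivableP.
- apply: derivable_within_continuous => x; rewrite in_itv/= => xpq.
  by have [] := g_C2 (in0l x xpq).
rewrite in_itv/= => /andP[px xq] hx.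
have : derive1 g q <= derive1 g p.
  rewrite -subr_le0 hx pmulr_lle0 ?subr_gt0// g_concave// in0l//.
  by rewrite (ltW px) ltW.
move=> gqp; rewrite mulrAC ler_wpM2r ?subr_ge0 ?(ltW bc)//.
by rewrite ler_wpM2r ?subr_ge0 ?(ltW ab).
Qed.

Hypothesis g0 : g 0 = 0.
Hypothesis gl : g l = 0.

Lemma concave_ge0 t : 0 < t < l -> 0 <= g t.
Proof.
move=> /andP[t0 tl].
have := concave_slopes (lexx 0) t0 tl (lexx l).
rewrite g0 gl !subr0 sub0r mulrBr => h.
by rewrite -(pmulr_lge0 _ l_gt0); lra.
Qed.

Lemma concave_right_derivative_ge0 :
  cvg ((g t - g 0) / (t - 0) @[t --> 0^'+]) -> 0 <= right_derivative g 0.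
Proof.
move=> cv; apply: limr_ge => //; near=> t.
rewrite g0 !subr0 divr_ge0// concave_ge0//.
by apply/andP; split.
Unshelve. all: by end_near. Qed.

Lemma concave_left_derivative_le0 :
  cvg ((g t - g l) / (t - l) @[t --> l^'-]) -> left_derivative g l <= 0.
Proof.
move=> cv; apply: limr_le => //; near=> t.
have tl : t < l by [].
rewrite gl subr0 mulr_ge0_le0 ?invr_le0 ?subr_le0 ?(ltW tl)//.
by rewrite concave_ge0// tl andbT.
Unshelve. all: by end_near. Qed.

(** By concavity the slope [g t / t] is at most every slope [g s / s] with
    [s < t], hence at most the right derivative at [0]. *)
Lemma concave_eq0 t : cvg ((g s - g 0) / (s - 0) @[s --> 0^'+]) ->
  right_derivative g 0 <= 0 -> 0 < t < l -> g t = 0.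
Proof.
move=> cv gd /andP[t0 tl]; apply/eqP; rewrite eq_le concave_ge0 ?t0// andbT.
suff : g t / t <= 0 by rewrite pmulr_lle0// invr_gt0.
apply: le_trans gd; apply: limr_ge => //; near=> s.
have s0 : 0 < s by [].
have st : s < t by [].
have := concave_slopes (lexx 0) s0 st (ltW tl).
rewrite g0 !subr0 mulrBl mulrBr => h.
by rewrite ler_pdivrMr// mulrAC ler_pdivlMr//; lra.
Unshelve. all: by end_near. Qed.

End ConcaveOnInterval.

(** * Edges, neighbors and the distance to a point *)

Section Distance.
Context (R : realType) (G : metric_graph R).

Lemma loc0 (e : edge G) : loc e 0 = Vtx (ini e).
Proof. by rewrite /loc; case: {-}_ / idP => [h|_]; [case/andP: (h); rewrite ltxx|rewrite lexx]. Qed.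

Lemma loc_len (e : edge G) : loc e (len e) = Vtx (fin e).
Proof.
rewrite /loc; case: {-}_ / idP => [h|_]; first by case/andP: (h); rewrite ltxx.
by rewrite leNgt len_gt0.
Qed.

Lemma loc_interior (e : edge G) t (h : 0 < t < len e) : loc e t = Pt e t h.
Proof.
by rewrite /loc; case: {-}_ / idP => [h'|//]; congr Pt; exact: bool_irrelevance.
Qed.

Lemma neighbor_sym (x y : vertex G) : neighbor x y -> neighbor y x.
Proof. by move=> [e [[-> ->]|[-> ->]]]; exists e; [right|left]. Qed.

Lemma path_length_ge0 (p q : gpoint G) L : path_length p q L -> 0 <= L.
Proof. by elim => // *; rewrite addr_ge0. Qed.

Lemma has_lbound_path_length (p q : gpoint G) :
  has_lbound [set L | path_length p q L].
Proof. by exists 0 => L /path_length_ge0. Qed.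

Hypothesis conn : connected_graph G.

Lemma gdist_ge0 (p q : gpoint G) : 0 <= gdist p q.
Proof.
apply: lb_le_inf; first by have [L hL] := conn p q; exists L.
by move=> L /path_length_ge0.
Qed.

(** Prepending the segment from [s] to [t] to the paths from [loc e t]. *)
Lemma gdist_step (e : edge G) s t q : 0 <= s <= len e -> 0 <= t <= len e ->
  gdist (loc e s) q <= `|s - t| + gdist (loc e t) q.
Proof.
move=> hs ht; rewrite -lerBlDl; apply: lb_le_inf.
  by have [L hL] := conn (loc e t) q; exists L.
move=> L hL; rewrite lerBlDl; apply: ge_inf.
  exact: has_lbound_path_length.
exact: path_step.
Qed.

Lemma gdist_neighbor (x y : vertex G) q : neighbor y x ->
  exists e : edge G, `|gdist (Vtx x) q - gdist (Vtx y) q| <= len e.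
Proof.
move=> [e he]; exists e.
have l0 := len_gt0 e.
have b0 : 0 <= (0 : R) <= len e by rewrite lexx ltW.
have bl : 0 <= len e <= len e by rewrite lexx ltW.
have := gdist_step q b0 bl; have := gdist_step q bl b0.
rewrite loc0 loc_len sub0r subr0 normrN gtr0_norm// => h1 h2.
by rewrite ler_norml; case: he => -[-> ->]; apply/andP; split; lra.
Qed.

Lemma finite_neighbors (x : vertex G) : locally_finite G ->
  finite_set [set y | neighbor y x].
Proof.
move=> lf; apply: (@sub_finite_set _ _
    ((@ini R G @` [set e | incident e x]) `|` (@fin R G @` [set e | incident e x]))).
  by move=> y [e [[-> xe]|[-> xe]]]; [left|right]; exists e => //; [right|left].
by rewrite finite_setU; split; apply: finite_image; exact: lf.
Qed.

End Distance.

(** * Vanishing on the whole graph *)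

Theorem theorem3p3 (R : realType) (G : metric_graph R)
  (mu : vertex G -> R) (mu_gt0 : forall x, 0 < mu x)
  (omega : vertex G -> vertex G -> R)
  (omega_sym : forall x y, omega x y = omega y x)
  (omega_gt0 : forall x y, neighbor x y -> 0 < omega x y)
  (x0 : vertex G)
  (hinf : infinite_graph G) (hconn : connected_graph G)
  (hlf : locally_finite G) (hloop : no_loops G)
  (hunb : unbounded_from x0) (hball : finite_balls x0)
  (hdeg : bounded_weighted_degree mu omega)
  (hlen : bounded_lengths G)
  (sigma : R) (hsigma : 1 < sigma)
  (V : gpoint G -> R) (V_gt0 : forall p, 0 < V p)
  (delta C : R) (hdelta : 0 < delta) (hC : 0 < C)
  (hV_vertices : forall r : R, base_radius G <= r ->
    (\esum_(x in vertices_in (gball_compl x0 r))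
       (mu x * V (Vtx x) `^ (- (1 / (sigma - 1)))
        * expR (- (delta / r) * gdist (Vtx x) (Vtx x0)))%:E
     <= (C * r `^ (sigma / (sigma - 1)))%:E)%E)
  (hV_edges : forall r : R, base_radius G <= r ->
    (\esum_(e in edges_meeting (gball_compl x0 r))
       \int[lebesgue_measure]_(t in `[0%R, len e])
         (restr V e t `^ (- (1 / (sigma - 1)))
          * expR (- (delta / r) * gdist (loc e t) (Vtx x0)))%:E
     <= (C * r `^ (sigma / (sigma - 1)))%:E)%E)
  (r1 : R) (hr1 : base_radius G <= r1)
  (u : gpoint G -> R)
  (hu : is_solution mu omega sigma V u)
  (huX : X_space mu x0 (delta / r1) u) :
  forall p : gpoint G, u p = 0.
Proof.
have [[u_cont uD] u_edge u_vtx u_kir] := hu.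
have [c c_gt0 om_deg] := hdeg.
have [len_ub _] := hlen.
pose d (x : vertex G) := gdist (Vtx x) (Vtx x0).
have d_ge0 x : 0 <= d x by exact: gdist_ge0.
have r0_gt0 : 0 < base_radius G by rewrite lt_max ltr01 orbT.
have u_V x : u (Vtx x) = 0.
  apply: (@vertex_liouville R (vertex G) (@neighbor R G) omega mu (V \o Vtx) d
    c (Num.max (len_sup G) 0) sigma _ _ _ _ mu_gt0 _ _ _ _ d_ge0 _ _ hsigma
    (u \o Vtx) _ delta C (base_radius G) r1 hdelta _ r0_gt0 _ _ hr1).
  - exact: neighbor_sym.
  - by move=> y; exact: finite_neighbors.
  - exact: omega_sym.
  - by move=> y y' /neighbor_sym /omega_gt0 /ltW.
  - by move=> y; exact: V_gt0.
  - exact: ltW.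
  - exact: om_deg.
  - by rewrite le_max lexx orbT.
  - move=> y y' /(gdist_neighbor hconn (Vtx x0))[e he].
    apply: (le_trans he); rewrite le_max; apply/orP; left.
    by apply: ub_le_sup => //; exists e.
  - move=> r; have m_gt0 : 0 < Num.max r 1 by rewrite lt_max ltr01 orbT.
    apply: sub_finite_set (hball _ m_gt0).1 => y /= dy.
    by rewrite /vertices_in /gball/= lt_max dy.
  - move=> y; have := u_vtx y; rewrite /vertex_laplacian => h.
    have := ler_wpM2l (ltW (mu_gt0 y)) h.
    by rewrite mulr0 mulrDr [in X in X + _ <= _]mulrA divff ?mul1r// gt_eqF.
  - exact: ltW.
  - by rewrite /base_radius !le_max; case: (leP (len_sup G) 0) => h;
      apply/orP; [right|left]; lra.
  - move=> r /hV_vertices; apply: le_trans.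
    by rewrite le_eqVlt; apply/orP; left; apply/eqP; apply: eq_esum => y _; rewrite mulNr.
  - apply: le_lt_trans huX.2.
    apply: (@le_trans _ _ (\esum_(x in [set: vertex G])
        (mu x * `|u (Vtx x)| * expR (- (delta / r1) * gdist (Vtx x) (Vtx x0)))%:E)%E).
      by apply: le_esum => y _; rewrite mulNr.
    rewrite leeDl//; apply: esum_ge0 => e _; apply: integral_ge0 => t _.
    by rewrite lee_fin mulr_ge0 ?expR_ge0.
have end0 e : restr u e 0 = 0 by rewrite /restr loc0.
have endl e : restr u e (len e) = 0 by rewrite /restr loc_len.
have concave e t : 0 < t < len e -> derive1n 2 (restr u e) t <= 0.
  move=> ht; apply: le_trans (u_edge e t ht); rewrite lerDl.
  by rewrite mulr_ge0 ?powR_ge0//; apply/ltW/V_gt0.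
have C2 e : C2_open (restr u e) 0 (len e) by have [] := uD e.
have C1 e : C1_closed (restr u e) 0 (len e) by have [] := uD e.
have normal_le0 e v : normal_derivative u e v <= 0.
  rewrite /normal_derivative; case: ifP => _.
    have [_ _ cvl _] := C1 e.
    exact: (concave_left_derivative_le0 (len_gt0 e) (u_cont e) (C2 e)
      (concave e) (end0 e) (endl e) cvl).
  rewrite oppr_le0.
  have [_ cv0 _ _] := C1 e.
  exact: (concave_right_derivative_ge0 (len_gt0 e) (u_cont e) (C2 e)
    (concave e) (end0 e) (endl e) cv0).
(* All the outward derivatives are nonpositive, and Kirchhoff's condition at
   ini e says that their sum is zero; so each of them is zero. *)
have right0 e : right_derivative (restr u e) 0 <= 0.
  have /eqP := u_kir (ini e); rewrite -oppr_eq0 /kirchhoff => /eqP sum0.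
  have sum0' : \sum_(e' \in [set e' | incident e' (ini e)])
      - normal_derivative u e' (ini e) = 0.
    by rewrite -[RHS]sum0 fsbig_finite// fsbig_finite// sumrN.
  have /eqP/negbTE ini_fin := @hloop e.
  have := pfsumr_eq0 (hlf (ini e)) _ sum0' (or_introl erefl : incident e _).
  rewrite /normal_derivative ini_fin opprK => -> // e' _.
  by rewrite oppr_ge0; exact: normal_le0.
case=> [x|e t h]; first exact: u_V.
rewrite -loc_interior -/(restr u e t).
have [_ cv0 _ _] := C1 e.
exact: (concave_eq0 (len_gt0 e) (u_cont e) (C2 e) (concave e) (end0 e)
  (endl e) cv0 (right0 e)).
Qed.
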